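(* Let $q$ be a prime power, let $\Gamma$ be a projective bundle in $\mathrm{PG}(2,q)$, let $A$ be the binary point-line incidence matrix of $\mathrm{PG}(2,q)$ and $B$ the binary point-oval incidence matrix of $\Gamma$ (rows indexed by points in the same order), and let $C=\ker(A\mid B)=\{c\in\mathbb{F}_2^{2(q^2+q+1)} : c(A\mid B)^\top=0\}$, so that the coordinates of $C$ are indexed by the lines of $\mathrm{PG}(2,q)$ followed by the ovals of $\Gamma$. Then the minimum distance of $C$ is $q+2$. Moreover, identifying the support of a codeword with a set of lines and ovals of $\Gamma$, the support of every minimum weight codeword of $C$ is: (i) if $q$ is odd, either an oval of $\Gamma$ together with its $q+1$ tangent lines, or a line together with its $q+1$ tangent ovals of $\Gamma$; (ii) if $q$ is even, either a dual hyperoval, or a hyperoval of ovals of $\Gamma$.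
   Context: $\mathrm{PG}(2,q)$ is the projective plane whose points and lines are the 1- and 2-dimensional subspaces of $\mathbb{F}_q^3$; it has $q^2+q+1$ points and lines. An oval is a set of $q+1$ points such that every line meets it in at most two points. A projective bundle is a collection of $q^2+q+1$ ovals of $\mathrm{PG}(2,q)$ any two of which intersect in exactly one point. A line and an oval are tangent if they meet in exactly one point. A dual hyperoval is a set of $q+2$ lines such that every point lies on zero or two of them. A hyperoval of ovals (of $\Gamma$) is a set of $q+2$ ovals of $\Gamma$ such that every point lies on zero or two of them. The minimum distance is the smallest Hamming weight of a nonzero codeword. *)

(* Defs.v *)
From mathcomp Require Import all_boot all_order all_algebra all_field.
Set Implicit Arguments. Unset Strict Implicit. Unset Printing Implicit Defensive.
Import GRing.Theory.
Local Open Scope ring_scope.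

Section PG2.
Variable F : finFieldType.

(* Subspaces of F^3 are represented canonically by their generated square
   matrix <<U>> (row space), so that equal subspaces are equal matrices. *)
Definition PGpoint : {set 'M[F]_3} :=
  [set U : 'M[F]_3 | (<<U>>%MS == U) && (\rank U == 1)%N].
Definition PGline : {set 'M[F]_3} :=
  [set U : 'M[F]_3 | (<<U>>%MS == U) && (\rank U == 2)%N].

Definition incident (p l : 'M[F]_3) : bool := (p <= l)%MS.

Definition is_oval (O : {set 'M[F]_3}) : bool :=
  [&& O \subset PGpoint, #|O| == (#|F| + 1)%N &
      [forall l in PGline, #|[set p in O | incident p l]| <= 2]]%N.

Definition projective_bundle (G : {set {set 'M[F]_3}}) : bool :=
  [&& [forall O in G, is_oval O],
      #|G| == (#|F| ^ 2 + #|F| + 1)%N &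
      [forall O1 in G, forall O2 in G, (O1 != O2) ==> (#|O1 :&: O2| == 1%N)]].

Definition in_code (G : {set {set 'M[F]_3}})
    (cL : {ffun 'M[F]_3 -> 'F_2}) (cO : {ffun {set 'M[F]_3} -> 'F_2}) : Prop :=
  [/\ forall l, l \notin PGline -> cL l = 0,
      forall o, o \notin G -> cO o = 0 &
      forall p, p \in PGpoint ->
        \sum_(l in PGline) cL l * (if incident p l then 1 else 0)
        + \sum_(o in G) cO o * (if p \in o then 1 else 0) = 0].

Definition suppL (cL : {ffun 'M[F]_3 -> 'F_2}) : {set 'M[F]_3} :=
  [set l | cL l != 0].
Definition suppO (cO : {ffun {set 'M[F]_3} -> 'F_2}) : {set {set 'M[F]_3}} :=
  [set o | cO o != 0].
Definition weight (cL : {ffun 'M[F]_3 -> 'F_2})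
    (cO : {ffun {set 'M[F]_3} -> 'F_2}) : nat :=
  (#|suppL cL| + #|suppO cO|)%N.

Definition tangent (l : 'M[F]_3) (O : {set 'M[F]_3}) : bool :=
  #|[set p in O | incident p l]| == 1%N.

Definition dual_hyperoval (D : {set 'M[F]_3}) : bool :=
  [&& D \subset PGline, #|D| == (#|F| + 2)%N &
      [forall p in PGpoint,
        let k := #|[set l in D | incident p l]| in (k == 0) || (k == 2)]]%N.

Definition hyperoval_of_ovals (G H : {set {set 'M[F]_3}}) : bool :=
  [&& H \subset G, #|H| == (#|F| + 2)%N &
      [forall p in PGpoint,
        let k := #|[set o in H | p \in o]| in (k == 0) || (k == 2)]]%N.

End PG2.

(* Main.v *)
Require Import Defs.
From mathcomp Require Import all_boot all_order all_algebra all_field.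
From mathcomp Require Import mxabelem zify.
Set Implicit Arguments. Unset Strict Implicit. Unset Printing Implicit Defensive.
Local Open Scope nat_scope.

(** The points with the ovals of the bundle form a second projective plane of order [q] on the
    same points, in which the lines of PG(2,q) are ovals; so lines and ovals play symmetric
    roles. Let a codeword consist of [a] lines and [b] ovals. Taking inner products with a
    line [m] shows that the number of chosen ovals tangent to [m] has the parity of
    [a + q [m chosen]].

    [q] odd: any two ovals share an odd number of tangent lines, and one on average, hence
    exactly one: lines and ovals form a third projective plane under tangency. If [a] is even
    and [b > 0], the chosen lines are those tangent to an odd number of chosen ovals, whence
    [a >= b (q + 2 - b)]. If [a] and [b] are odd, every line not chosen is tangent to a chosen
    oval, whence [q^2 + q + 1 - a <= b q + 1].

    [q] even: the ovals have distinct nuclei, so the [b] nuclei form a set meeting every line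
    in a number of points of the parity of [a]; hence [b > q] as soon as [b > 0], and
    symmetrically for [a]. A dual hyperoval is obtained from an oval and its nucleus by
    the orthogonal polarity. *)

(** * Counting, parity and second moments of finite sums *)

Lemma sum_indicator (T : finType) (S : {pred T}) :
  \sum_x (x \in S : nat) = #|S|.
Proof. by rewrite -sum1_card [RHS]big_mkcond. Qed.

Lemma sum_bool (T : finType) (S b : {pred T}) :
  \sum_(x in S) (b x : nat) = #|[set x in S | b x]|.
Proof.
rewrite -sum1_card big_mkcond [RHS]big_mkcond; apply: eq_bigr => x _.
by rewrite inE; case: (x \in S); case: (b x).
Qed.

Lemma odd_sum (T : finType) (S : {pred T}) (f g : T -> nat) :
  (forall x, x \in S -> odd (f x) = odd (g x)) ->
  odd (\sum_(x in S) f x) = odd (\sum_(x in S) g x).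
Proof.
move=> fg; apply: (big_ind2 (fun a b => odd a = odd b)) => //.
by move=> a b c d ab cd; rewrite !oddD ab cd.
Qed.

(** Zero variance: the moments give equality in the sum of [2 * (f x * k) <= f x ^ 2 + k ^ 2], hence
    in each term. *)
Lemma eq_of_moments (T : finType) (A : {pred T}) (f : T -> nat) (k : nat) :
  \sum_(x in A) f x = k * #|A| -> \sum_(x in A) f x ^ 2 = k ^ 2 * #|A| ->
  forall x, x \in A -> f x = k.
Proof.
move=> m1 m2.
have h : forall x, x \in A -> 2 * (f x * k) <= f x ^ 2 + k ^ 2 ?= iff (f x == k).
  by move=> x _; apply: nat_Cauchy.
have [_] := leqif_sum h.
have -> : \sum_(x in A) 2 * (f x * k) = \sum_(x in A) (f x ^ 2 + k ^ 2).
  rewrite -big_distrr -big_distrl /= m1 big_split /= m2 sum_nat_const.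
  by lia.
rewrite eqxx => /esym/forall_inP e x xA; exact/eqP/e.
Qed.

Lemma sum_gt0_in (T : finType) (A : {pred T}) (f : T -> nat) :
  0 < \sum_(x in A) f x -> exists2 x, x \in A & 0 < f x.
Proof.
rewrite lt0n sum_nat_eq0 => /forall_inPn [x xA fx].
by exists x => //; rewrite lt0n.
Qed.

(** * Projective planes as square designs *)

(* The case [l = l'] of [plane_meet] gives the block size [q + 1]; dually for [plane_join]. *)
Record plane (P L : finType) (q : nat) (i : P -> L -> bool) : Prop := Plane {
  plane_points : #|P| = q ^ 2 + q + 1;
  plane_lines : #|L| = q ^ 2 + q + 1;
  plane_meet : forall l l', \sum_p i p l * i p l' = q * (l == l') + 1;
  plane_join : forall p p', \sum_l i p l * i p' l = q * (p == p') + 1 }.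

Lemma plane_dual (P L : finType) q (i : P -> L -> bool) :
  plane q i -> plane q (fun l p => i p l).
Proof. by case=> *; constructor. Qed.

Section Design.
Variables (P L : finType) (q : nat) (i : P -> L -> bool).
Hypothesis meet : forall l l', \sum_p i p l * i p l' = q * (l == l') + 1.

Lemma block_size l : \sum_p i p l = q.+1.
Proof.
have := meet l l; rewrite eqxx muln1 addn1 => <-.
by apply: eq_bigr => p _; case: (i p l).
Qed.

(** Every member of [S] meets [m] once, with [q] more if it is [m]. Modulo 2 this is the inner
    product with a line. *)
Lemma meet_family (S : {set L}) m :
  \sum_p i p m * \sum_(l in S) i p l = #|S| + q * (m \in S).
Proof.
under eq_bigr do rewrite big_distrr /=.
rewrite exchange_big /=.
under eq_bigr do rewrite meet.
rewrite big_split /= sum1_card -big_distrr /= addnC; congr (_ + _ * _).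
case: (boolP (m \in S)) => mS.
  rewrite (bigD1 m) //= eqxx big1 ?addn0 // => l /andP[_].
  by rewrite eq_sym => /negPf->.
by rewrite big1 // => l lS; case: eqP => // e; rewrite e lS in mS.
Qed.

Lemma sum_degree (S : {set L}) : \sum_p \sum_(l in S) i p l = #|S| * q.+1.
Proof.
rewrite exchange_big /=; under eq_bigr do rewrite block_size.
by rewrite sum_nat_const.
Qed.

Lemma sum_degree_sqr (S : {set L}) :
  \sum_p (\sum_(l in S) i p l) ^ 2 = #|S| * (#|S| + q).
Proof.
under eq_bigr do rewrite -mulnn big_distrl /=.
rewrite exchange_big /=.
rewrite (eq_bigr (fun=> #|S| + q)) ?sum_nat_const // => m mS.
by rewrite meet_family mS muln1.
Qed.

(* Each term [d (2 - d)] of the difference of the two moments is at most [odd d]. *)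
Lemma odd_degree_lb (S : {set L}) :
  #|S| * (q + 2) <= #|[set p | odd (\sum_(l in S) i p l)]| + #|S| * #|S|.
Proof.
rewrite -(sum_indicator [set p | _]).
have : \sum_p 2 * \sum_(l in S) i p l <=
  \sum_p ((p \in [set p | odd (\sum_(l in S) i p l)]) + (\sum_(l in S) i p l) ^ 2).
  apply: leq_sum => p _; rewrite inE.
  by case: (\sum_(l in S) _) => [|[|n]] //; rewrite -mulnn; nia.
rewrite -big_distrr big_split /= sum_degree sum_degree_sqr.
by lia.
Qed.

(** A fixed [m] in [S] covers [q + 1] points; each other member meets [m] once and adds at most
    [q]. *)
Lemma covered_ub (S : {set L}) :
  0 < #|S| -> #|[set p | 0 < \sum_(l in S) i p l]| <= #|S| * q + 1.
Proof.
move=> /card_gt0P [m mS]; rewrite -(sum_indicator [set p | _]).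
apply: (@leq_trans (\sum_p (i p m + \sum_(l in S :\ m) (i p l * ~~ i p m)))).
  apply: leq_sum => p _; rewrite inE (big_setD1 m) //=.
  case: (i p m) => //=; rewrite !add0n.
  under [leqRHS]eq_bigr do rewrite muln1.
  by case: (\sum_(l in S :\ m) i p l).
rewrite big_split /= block_size exchange_big /=.
rewrite (eq_bigr (fun=> q)); last first.
  move=> l; rewrite !inE => /andP[lm _].
  have := meet l m; rewrite (negPf lm) muln0.
  have : \sum_p (i p l * ~~ i p m + i p l * i p m) = q.+1.
    rewrite -(block_size l); apply: eq_bigr => p _.
    by case: (i p l); case: (i p m).
  by rewrite big_split /=; lia.
by rewrite sum_nat_const (cardsD1 m S) mS; lia.
Qed.

(** Two zero-variance arguments give the dual axiom: every point has degree [q + 1], then two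
    distinct points are joined once. *)
Lemma square_design_plane :
  #|P| = q ^ 2 + q + 1 -> #|L| = q ^ 2 + q + 1 -> plane q i.
Proof.
move=> cP cL.
have cPT : #|@predT P| = q ^ 2 + q + 1 by [].
have deg p : \sum_l i p l = q.+1.
  have sT p' : \sum_(l in [set: L]) i p' l = \sum_l i p' l.
    by apply: eq_bigl => l; rewrite inE.
  apply: (@eq_of_moments _ predT (fun p => \sum_l i p l)) => //.
    have := sum_degree [set: L]; under eq_bigr do rewrite sT.
    by move=> ->; rewrite cardsT cL cPT mulnC.
  have := sum_degree_sqr [set: L]; under eq_bigr do rewrite sT.
  by move=> ->; rewrite cardsT cL cPT; lia.
split=> // p.
have self : \sum_l i p l * i p l = q.+1.
  by rewrite -(deg p); apply: eq_bigr => l _; case: (i p l).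
move=> p'; have [<-|ne] := eqVneq p p'; first by rewrite self; lia.
rewrite muln0 add0n.
have cp : #|predC1 p| = q ^ 2 + q.
  by have := cardC1 p; rewrite cP; lia.
have inC x : (x \in predC1 p) = (x != p) by rewrite inE.
(* Both moments are computed over all points first; then the term at [p] is removed. *)
apply: (@eq_of_moments _ (predC1 p) (fun p' => \sum_l i p l * i p' l)); last 1 first.
- by rewrite inE eq_sym.
- have : \sum_p' \sum_l i p l * i p' l = q.+1 * q.+1.
    rewrite exchange_big /=.
    under eq_bigr do rewrite -big_distrr block_size.
    by rewrite -big_distrl /= deg.
  by rewrite (bigD1 p) //= self cp (eq_bigl _ _ inC); lia.
(* This counts triples [(p', l, l')] with both lines through [p] and [p']. For a given [l] through
   [p], the [q + 1] lines [l'] through [p] contribute 1 each, and [l' = l] another [q]. *)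
- have : \sum_p' (\sum_l i p l * i p' l) ^ 2 = q.+1 * (q.+1 + q).
    under eq_bigr => x _ do rewrite -mulnn big_distrl /=.
    rewrite exchange_big /= -[X in X * (_ + _)](deg p) big_distrl /=.
    apply: eq_bigr => l _.
    under eq_bigr do rewrite -mulnA.
    rewrite -big_distrr /=; case: (boolP (i p l)) => // ipl; congr (_ * _).
    under eq_bigr do rewrite big_distrr /=.
    rewrite exchange_big /= (eq_bigr (fun l' => i p l' * (q * (l == l') + 1))).
      under eq_bigr do rewrite mulnDr muln1.
      rewrite big_split /= deg addnC; congr (_ + _).
      rewrite (bigD1 l) //= eqxx ipl big1; first by lia.
      by move=> l'; rewrite eq_sym => /negPf->; rewrite muln0 muln0.
    move=> l' _; rewrite -meet big_distrr /=; apply: eq_bigr => x _.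
    by lia.
  by rewrite (bigD1 p) //= self cp (eq_bigl _ _ inC) -mulnn; lia.
Qed.

End Design.

(** * Ovals *)

(** A point set is any Boolean predicate, so that the blocks of one plane can serve as ovals of
    another. *)
Definition inter (P L : finType) (i : P -> L -> bool) (o : P -> bool) (l : L) : nat :=
  \sum_p i p l * o p.

Definition is_tangent (P L : finType) (i : P -> L -> bool) (o : P -> bool) (l : L) : bool :=
  inter i o l == 1.

Lemma sum_delta (T : finType) (x : T) (f : T -> nat) : \sum_y (x == y) * f y = f x.
Proof.
rewrite (bigD1 x) //= eqxx mul1n big1 ?addn0 // => y.
by rewrite eq_sym => /negPf->.
Qed.

Section Ovals.
Variables (P L : finType) (q : nat) (i : P -> L -> bool).
Hypothesis pl : plane q i.
Let meet := plane_meet pl.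
Let join := plane_join pl.
Let line_size := block_size meet.
Let point_degree : forall p, \sum_l i p l = q.+1 := block_size join.

(** For the incidence matrix [N] this evaluates the bilinear form of [N N^T = q I + J] at [a] and
    [b]. *)
Lemma sum_inter_mul (a b : P -> bool) :
  \sum_l inter i a l * inter i b l =
  q * (\sum_p a p * b p) + (\sum_p a p) * (\sum_p b p).
Proof.
under eq_bigr do rewrite big_distrl /=.
rewrite exchange_big /= big_distrl big_distrr -big_split /=.
apply: eq_bigr => p _.
under eq_bigr do rewrite big_distrr /=.
rewrite exchange_big /= (eq_bigr (fun p' => a p * b p' * (q * (p == p') + 1))).
  under eq_bigr do rewrite mulnDr muln1.
  rewrite big_split /= -big_distrr /=; congr (_ + _).
  rewrite -[q * (_ * _)]mulnC -(sum_delta p (fun p' => a p * b p')) big_distrl /=.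
  by apply: eq_bigr => p' _; lia.
move=> p' _; rewrite -join big_distrr /=; apply: eq_bigr => l _.
by lia.
Qed.

Section OneOval.
Variable o : P -> bool.
Hypothesis o_size : \sum_p o p = q.+1.
Hypothesis o_le2 : forall l, inter i o l <= 2.

Lemma odd_is_tangent l : odd (is_tangent i o l) = odd (inter i o l).
Proof. by rewrite /is_tangent; move: (o_le2 l); case: (inter i o l) => [|[|[|]]]. Qed.

Lemma sum_inter_through p : \sum_l i p l * inter i o l = q * o p + q.+1.
Proof.
under eq_bigr do rewrite big_distrr /=.
rewrite exchange_big /= (eq_bigr (fun p' => q * ((p == p') * o p') + o p')).
  by rewrite big_split /= -big_distrr /= sum_delta o_size.
move=> p' _; rewrite mulnA -[X in _ = _ + X]mul1n -mulnDl -join big_distrl /=.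
by apply: eq_bigr => l _; rewrite mulnA.
Qed.

(** The [q + 1] lines through [p] meet the oval [2q + 1] times in total, each once or twice. *)
Lemma tangents_on p : o p -> \sum_l i p l * is_tangent i o l = 1.
Proof.
move=> op.
have : \sum_l (i p l * is_tangent i o l + i p l * inter i o l) = \sum_l 2 * i p l.
  apply: eq_bigr => l _; case: (boolP (i p l)) => // ipl; rewrite !mul1n /is_tangent.
  have : 0 < inter i o l by rewrite /inter (bigD1 p) //= ipl op.
  by move: (o_le2 l); case: (inter i o l) => [|[|[|]]].
by rewrite big_split /= -big_distrr /= sum_inter_through point_degree op; lia.
Qed.

(** The lines through [p] partition the [q + 1] points of the oval, and the tangents are those with
    odd trace. *)
Lemma tangents_off_parity p :
  ~~ o p -> odd (\sum_l i p l * is_tangent i o l) = odd q.+1.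
Proof.
move=> op; rewrite -[q.+1]add0n -[X in X + _](muln0 q) -[X in _ * X](_ : nat_of_bool (o p) = _).
  rewrite -sum_inter_through; apply: odd_sum => l _.
  by rewrite !oddM odd_is_tangent.
by rewrite (negPf op).
Qed.

(** Count pairs of an oval point and a tangent through it: one tangent per point, one point per
    tangent. *)
Lemma sum_tangents : \sum_l is_tangent i o l = q.+1.
Proof.
rewrite -o_size [RHS](eq_bigr (fun p => o p * \sum_l i p l * is_tangent i o l)).
  under [RHS]eq_bigr do rewrite big_distrr /=.
  rewrite [RHS]exchange_big; apply: eq_bigr => l _ /=.
  rewrite [RHS](eq_bigr (fun p => i p l * o p * is_tangent i o l)) => [|p _]; last by lia.
  by rewrite -big_distrl -/(inter i o l) /is_tangent /=; case: eqP => [->|]; rewrite ?muln0.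
by move=> p _; case: (boolP (o p)) => // op; rewrite tangents_on.
Qed.

(* A line meeting the oval in 0 or 2 points is crossed by the [q + 1] tangents, at least
   once in each of its points, hence exactly once; so two tangents can only meet in a
   point all of whose lines are tangents. *)
Lemma nucleus : ~~ odd q -> 0 < q -> exists n, forall l, is_tangent i o l = i n l.
Proof.
move=> q_even q_gt0.
have tan_ge1 p : 1 <= \sum_l i p l * is_tangent i o l.
  have [/tangents_on -> //|/tangents_off_parity] := boolP (o p).
  by case: (\sum_l _) => //=; rewrite q_even.
have once m p : ~~ is_tangent i o m -> i p m -> \sum_l i p l * is_tangent i o l = 1.
  move=> mt ipm.
  have : \sum_p' i p' m * (\sum_l i p' l * is_tangent i o l) = q.+1.
    under eq_bigr do rewrite big_distrr /=.
    rewrite exchange_big /= -sum_tangents; apply: eq_bigr => l _.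
    under eq_bigr do rewrite mulnA.
    rewrite -big_distrl /=; case: (boolP (is_tangent i o l)) => lt; last by rewrite muln0.
    by rewrite meet; case: eqP lt mt => [-> ->|_ _ _] //; rewrite muln0.
  rewrite (bigD1 p) //= ipm mul1n.
  have : \sum_(p' | p' != p) i p' m <=
    \sum_(p' | p' != p) i p' m * (\sum_l i p' l * is_tangent i o l).
    by apply: leq_sum => p' _; rewrite -{1}[_ (i p' m)]muln1 leq_mul.
  have := line_size m; rewrite (bigD1 p) //= ipm.
  by move: (tan_ge1 p); lia.
have two_tangents : exists t t', [/\ t != t', is_tangent i o t & is_tangent i o t'].
  have : 1 < #|[set l | is_tangent i o l]|.
    by rewrite -sum_indicator; under eq_bigr do rewrite inE; rewrite sum_tangents.
  by case/card_gt1P => t [t'] []; rewrite !inE => ? ? ?; exists t, t'.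
case: two_tangents => t [t'] [tt' tant tant'].
have : 0 < \sum_p i p t * i p t' by rewrite meet addn1.
case/sum_gt0_in => n _; rewrite muln_gt0 !lt0b => /andP[nt nt'].
have all_tan l : i n l -> is_tangent i o l.
  move=> nl; apply/negPn/negP => lt.
  have := once l n lt nl.
  rewrite (bigD1 t) //= nt tant (bigD1 t') 1?eq_sym //= nt' tant'; lia.
exists n => l; apply/idP/idP => [lt|]; last exact: all_tan.
(* Conversely, the [q + 1] lines through [n] already exhaust the [q + 1] tangents. *)
apply/negPn/negP => nl.
have : \sum_l i n l < \sum_l is_tangent i o l; last first.
  by rewrite sum_tangents point_degree ltnn.
rewrite [ltnRHS](bigD1 l) //= [ltnLHS](bigD1 l) //= lt (negPf nl) add0n add1n ltnS.
by apply: leq_sum => l' _; case: (boolP (i n l')) => // /all_tan->.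
Qed.

Lemma nucleus_off n : (forall l, is_tangent i o l = i n l) -> 0 < q -> ~~ o n.
Proof.
move=> tn q_gt0; apply/negP => /tangents_on.
under eq_bigr do rewrite tn mulnb andbb.
by rewrite point_degree => -[q0]; rewrite q0 in q_gt0.
Qed.

End OneOval.

(** Modulo 2 tangency is intersection size, so the count has the parity of [q + (q + 1)^2]. *)
Lemma odd_common_tangents (a b : P -> bool) :
  \sum_p a p = q.+1 -> \sum_p b p = q.+1 -> \sum_p a p * b p = 1 ->
  (forall l, inter i a l <= 2) -> (forall l, inter i b l <= 2) ->
  odd q -> odd (\sum_l is_tangent i a l * is_tangent i b l).
Proof.
move=> sa sb sab la lb q_odd.
rewrite (@odd_sum _ _ _ (fun l => inter i a l * inter i b l)).
  by rewrite sum_inter_mul sa sb sab muln1 oddD oddM /= q_odd.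
by move=> l _; rewrite !oddM !odd_is_tangent.
Qed.

(* Join [p] to every point of [X]: distinct lines through [p] have disjoint traces on [X]. *)
Lemma blocking_ge (X : {set P}) p :
  p \notin X -> (forall l, i p l -> 0 < \sum_(x in X) i x l) -> q < #|X|.
Proof.
move=> pX cov.
have : \sum_l i p l * \sum_(x in X) i x l = #|X|.
  under eq_bigr do rewrite big_distrr /=.
  rewrite exchange_big /= -sum1_card; apply: eq_bigr => x xX.
  by rewrite join; case: eqP pX xX => [->|_ _ _]; [case: (_ \in _) | rewrite muln0].
move=> <-; rewrite -(point_degree p); apply: leq_sum => l _.
by case: (boolP (i p l)) => // /cov; rewrite mul1n.
Qed.

Lemma odd_blocking_ge (X : {set P}) :
  (forall l, odd (\sum_(x in X) i x l)) -> q < #|X|.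
Proof.
move=> cov; have [XT|] := eqVneq X [set: P].
  by rewrite XT cardsT (plane_points pl); nia.
rewrite -subTset => /subsetPn[p _ pX]; apply: (blocking_ge pX) => l _.
by move: (cov l); case: (\sum_(x in X) _).
Qed.

(** By parity each line through a point [p] of [X] meets [X] again, so [X] without [p] blocks the
    lines through [p]. *)
Lemma even_set_ge (X : {set P}) :
  0 < #|X| -> (forall l, ~~ odd (\sum_(x in X) i x l)) -> q + 2 <= #|X|.
Proof.
case/card_gt0P => p pX ev; rewrite (cardsD1 p) pX addn2 add1n ltnS.
apply: (@blocking_ge _ p); first by rewrite !inE eqxx.
move=> l ipl; have := ev l; rewrite (big_setD1 p) //= ipl.
by case: (\sum_(x in _ :\ _) _).
Qed.

(** An even [d] satisfies [2d <= d^2], with equality only at 0 and 2; for [q + 2] points the two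
    sides have equal sums over the lines. *)
Lemma even_set_degrees (X : {set P}) l :
  #|X| = q + 2 -> (forall l, ~~ odd (\sum_(x in X) i x l)) ->
  (\sum_(x in X) i x l == 0) || (\sum_(x in X) i x l == 2).
Proof.
move=> cX ev.
have h (l' : L) : l' \in predT ->
    2 * \sum_(x in X) i x l' <= (\sum_(x in X) i x l') ^ 2
    ?= iff ((\sum_(x in X) i x l' == 0) || (\sum_(x in X) i x l' == 2)).
  move=> _; have := ev l'.
  case: (\sum_(x in X) _) => [|[|[|n]]] // _; split; first by nia.
  by apply/negP => /eqP; nia.
have [_] := leqif_sum h.
rewrite -big_distrr /= (@sum_degree _ _ q (fun l p => i p l) join).
rewrite (@sum_degree_sqr _ _ q (fun l p => i p l) join) cX.
rewrite (_ : _ == _); last by apply/eqP; lia.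
by move=> /esym/forall_inP/(_ l isT).
Qed.

End Ovals.

(** * Two planes on the same points, the lines of each being ovals of the other *)

Lemma eq_of_leq_sum (T : finType) (f g : T -> nat) :
  (forall x, f x <= g x) -> \sum_x g x <= \sum_x f x -> forall x, f x = g x.
Proof.
move=> fg sums x.
have h (y : T) : y \in predT -> f y <= g y ?= iff (f y == g y) by split.
have [le] := leqif_sum h.
by rewrite eqn_leq le sums => /esym/forall_inP/(_ x isT)/eqP.
Qed.

Section BundleDefs.
Variables (P L O : finType) (q : nat) (i1 : P -> L -> bool) (i2 : P -> O -> bool).

(** The last field is symmetric: it makes the blocks of each plane ovals of the other, their size
    being [q + 1] by the plane axioms. *)
Record bundle : Prop := Bundle {
  bundle_plane1 : plane q i1;
  bundle_plane2 : plane q i2;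
  bundle_le2 : forall l o, \sum_p i1 p l * i2 p o <= 2 }.

Definition tan (l : L) (o : O) : bool := is_tangent i1 (fun p => i2 p o) l.

Definition codeword (S1 : {set L}) (S2 : {set O}) : Prop :=
  forall p, odd (\sum_(l in S1) i1 p l) = odd (\sum_(o in S2) i2 p o).

End BundleDefs.

Lemma bundle_sym (P L O : finType) q (i1 : P -> L -> bool) (i2 : P -> O -> bool) :
  bundle q i1 i2 -> bundle q i2 i1.
Proof.
by case=> pl1 pl2 le2; split=> // o l; under eq_bigr do rewrite mulnC.
Qed.

Lemma tanC (P L O : finType) (i1 : P -> L -> bool) (i2 : P -> O -> bool) l o :
  tan i2 i1 o l = tan i1 i2 l o.
Proof.
by rewrite /tan /is_tangent /inter; under eq_bigr do rewrite mulnC.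
Qed.

Lemma codeword_sym (P L O : finType) (i1 : P -> L -> bool) (i2 : P -> O -> bool) S1 S2 :
  codeword i1 i2 S1 S2 -> codeword i2 i1 S2 S1.
Proof. by move=> cw p; rewrite cw. Qed.

Section Bundle.
Variables (P L O : finType) (q : nat) (i1 : P -> L -> bool) (i2 : P -> O -> bool).
Hypothesis bd : bundle q i1 i2.
Let pl1 := bundle_plane1 bd.
Let pl2 := bundle_plane2 bd.
Let le2 := bundle_le2 bd.
Let oval_size o : \sum_p i2 p o = q.+1 := block_size (plane_meet pl2) o.
Notation tg := (tan i1 i2).

Lemma odd_tan l o : odd (tg l o) = odd (\sum_p i1 p l * i2 p o).
Proof. exact: (odd_is_tangent (fun l => le2 l o)). Qed.

(** Sum the codeword condition over the points of [m]; an oval meeting [m] in 0 or 2 points drops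
    out modulo 2. *)
Lemma codeword_tangents (S1 : {set L}) (S2 : {set O}) m :
  codeword i1 i2 S1 S2 ->
  odd (\sum_(o in S2) tg m o) = odd (#|S1| + q * (m \in S1)).
Proof.
move=> cw; rewrite -(meet_family (plane_meet pl1)).
rewrite (@odd_sum _ _ _ (fun o => \sum_p i1 p m * i2 p o)); last first.
  by move=> o _; exact: odd_tan.
rewrite exchange_big /=; apply: odd_sum => p _.
by rewrite -big_distrr !oddM -cw.
Qed.

(** This is the word of weight [q + 2] for odd [q]: one tangent at each point of the oval, an even
    number elsewhere. *)
Lemma oval_tangents_codeword o :
  odd q -> codeword i1 i2 [set l | tg l o] [set o].
Proof.
move=> q_odd p; rewrite big_set1.
have -> : \sum_(l in [set l | tg l o]) i1 p l = \sum_l i1 p l * tg l o.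
  rewrite big_mkcond; apply: eq_bigr => l _; rewrite inE.
  by case: (tg l o); rewrite ?muln1 ?muln0.
case: (boolP (i2 p o)) => po.
  by rewrite (tangents_on pl1 (oval_size o) (fun l => le2 l o) po).
by rewrite (tangents_off_parity pl1 (oval_size o) (fun l => le2 l o) po) /= q_odd.
Qed.

Lemma card_tangents o : #|[set l | tg l o]| = q.+1.
Proof.
rewrite -sum_indicator; under eq_bigr do rewrite inE.
exact: (sum_tangents pl1 (oval_size o) (fun l => le2 l o)).
Qed.

Section Even.
Hypotheses (q_even : ~~ odd q) (q_gt0 : 0 < q).

Lemma nuclei : exists n : O -> P, forall o l, tg l o = i1 (n o) l.
Proof.
apply: (@fin_all_exists _ (fun=> P) (fun o n => forall l, tg l o = i1 n l)) => o.
exact: (nucleus pl1 (oval_size o) (fun l => le2 l o) q_even q_gt0).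
Qed.

End Even.
End Bundle.

(* If [o] and [o'] had the same nucleus [x], every line [l] through [x] would be tangent to
   both, so the nucleus of [l] in the plane of ovals would be their common point [z]. Then
   all ovals through [z] have nucleus [x], but one of them contains [x]. *)
Lemma nuclei_inj (P L O : finType) q (i1 : P -> L -> bool) (i2 : P -> O -> bool) n :
  bundle q i1 i2 -> ~~ odd q -> 0 < q ->
  (forall o l, tan i1 i2 l o = i1 (n o) l) -> injective n.
Proof.
move=> bd q_even q_gt0 tn o o' noo'; apply/eqP/negPn/negP => oo'.
have [pl1 pl2 le2] := bd.
have [m tm] := nuclei (bundle_sym bd) q_even q_gt0.
have tmn l a : i2 (m l) a = i1 (n a) l by rewrite -tm tanC tn.
have cm := plane_meet pl2 o o'; rewrite (negPf oo') muln0 in cm.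
have [z _] : exists2 z, z \in P & 0 < i2 z o * i2 z o'.
  by apply: sum_gt0_in; rewrite cm.
rewrite muln_gt0 !lt0b => /andP[zo zo'].
have mz l : i1 (n o) l -> m l = z.
  move=> ol; apply/eqP/negPn/negP => mlz.
  move: cm; rewrite (bigD1 z) //= zo zo' (bigD1 (m l)) //= !tmn -noo' ol; lia.
have nz a : i2 z a -> n a = n o.
  move=> za; apply/eqP/negPn/negP => nao.
  have := plane_join pl1 (n o) (n a); rewrite eq_sym (negPf nao) muln0.
  rewrite (eq_bigr (fun l => i1 (n o) l : nat)) => [|l _].
    by rewrite (block_size (plane_join pl1)); lia.
  by case: (boolP (i1 (n o) l)) => //= ol; rewrite -tmn (mz l ol) za.
have [a _] : exists2 a, a \in O & 0 < i2 z a * i2 (n o) a.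
  by apply: sum_gt0_in; rewrite (plane_join pl2) addn1.
rewrite muln_gt0 !lt0b => /andP[za na].
have := nucleus_off pl1 (block_size (plane_meet pl2) a) (fun l => le2 l a) (tn a) q_gt0.
by rewrite (nz a za) na.
Qed.

Lemma card_chosen_ovals_even (P L O : finType) q (i1 : P -> L -> bool) (i2 : P -> O -> bool)
    (S1 : {set L}) (S2 : {set O}) :
  bundle q i1 i2 -> ~~ odd q -> 0 < q -> codeword i1 i2 S1 S2 -> 0 < #|S2| ->
  q < #|S2|.
Proof.
move=> bd q_even q_gt0 cw S2_gt0.
have [n tn] := nuclei bd q_even q_gt0.
have n_inj := nuclei_inj bd q_even q_gt0 tn.
have par l : odd (\sum_(x in n @: S2) i1 x l) = odd #|S1|.
  rewrite big_imset => [|? ? _ _ /n_inj//] /=.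
  under eq_bigr do rewrite -tn.
  by rewrite (codeword_tangents bd _ cw) oddD oddM (negPf q_even) addbF.
have cX : #|n @: S2| = #|S2| by rewrite card_imset.
case: (boolP (odd #|S1|)) par => _ par; rewrite -cX.
  exact: (odd_blocking_ge (bundle_plane1 bd)).
have : q + 2 <= #|n @: S2|; last by lia.
apply: (even_set_ge (bundle_plane1 bd)); first by rewrite cX.
by move=> l; rewrite par.
Qed.

(** If both parts are nonempty, each exceeds [q], for a total above [q + 2]. Otherwise the word is
    an even set in the dual of one plane. *)
Lemma min_weight_even (P L O : finType) q (i1 : P -> L -> bool) (i2 : P -> O -> bool)
    (S1 : {set L}) (S2 : {set O}) :
  bundle q i1 i2 -> ~~ odd q -> 0 < q -> codeword i1 i2 S1 S2 -> 0 < #|S1| + #|S2| ->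
  q + 2 <= #|S1| + #|S2| /\ (#|S1| + #|S2| = q + 2 -> S1 = set0 \/ S2 = set0).
Proof.
move=> bd q_even q_gt0 cw.
have [/eqP|S2_gt0] := posnP #|S2|.
  rewrite cards_eq0 => /eqP S20; rewrite S20 cards0 addn0 => S1_gt0.
  split; last by right.
  apply: (even_set_ge (plane_dual (bundle_plane1 bd))) => // p.
  by rewrite cw S20 big_set0.
have [/eqP|S1_gt0 _] := posnP #|S1|.
  rewrite cards_eq0 => /eqP S10; rewrite S10 cards0 add0n => _.
  split; last by left.
  apply: (even_set_ge (plane_dual (bundle_plane2 bd))) => // p.
  by rewrite -cw S10 big_set0.
have := card_chosen_ovals_even bd q_even q_gt0 cw S2_gt0.
have := card_chosen_ovals_even (bundle_sym bd) q_even q_gt0 (codeword_sym cw) S1_gt0.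
by split; lia.
Qed.

Lemma dual_hyperoval_exists (P L : finType) q (i : P -> L -> bool) (o : P -> bool)
    (perp : P -> L) :
  plane q i -> ~~ odd q -> 0 < q -> \sum_p o p = q.+1 -> (forall l, inter i o l <= 2) ->
  injective perp -> (forall p p', i p (perp p') = i p' (perp p)) ->
  exists S : {set L}, #|S| = q + 2 /\ forall p, ~~ odd (\sum_(l in S) i p l).
Proof.
move=> pl q_even q_gt0 o_size o_le2 perp_inj perpC.
have [n tn] := nucleus pl o_size o_le2 q_even q_gt0.
have no := nucleus_off pl o_size o_le2 tn q_gt0.
have nX : n \notin [set p | o p] by rewrite inE.
exists (perp @: (n |: [set p | o p])); split=> [|p].
  rewrite card_imset // cardsU1 nX -sum_indicator; under eq_bigr do rewrite inE.
  by rewrite o_size; lia.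
(* The lines through [p] correspond to the points of oval plus nucleus on [perp p]. The nucleus lies
   there exactly when [perp p] is tangent, that is, meets the oval oddly. *)
rewrite big_imset => [|? ? _ _ /perp_inj//] /=; rewrite big_setU1 //= oddD perpC -tn.
rewrite (odd_is_tangent o_le2) -oddD /inter.
under [X in _ + X]eq_bigr do rewrite perpC.
rewrite [X in _ + X]big_mkcond /= -big_split /=.
rewrite (eq_bigr (fun x => 2 * (i x (perp p) * o x))) -?big_distrr ?oddM //= => x _.
by rewrite inE; case: (o x); case: (i x _).
Qed.

(** * Odd order: the plane of tangency and its counting bounds *)

Section Odd.
Variables (P L O : finType) (q : nat) (i1 : P -> L -> bool) (i2 : P -> O -> bool).
Hypotheses (bd : bundle q i1 i2) (q_odd : odd q).

(* Any two ovals have an odd number of common tangents, and on average exactly one. *)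
Lemma tangency_plane : plane q (tan i1 i2).
Proof.
have [pl1 pl2 le2] := bd.
have osz o : \sum_p i2 p o = q.+1 by rewrite (block_size (plane_meet pl2)).
have lsz l : \sum_p i1 p l = q.+1 by rewrite (block_size (plane_meet pl1)).
have st o : \sum_l tan i1 i2 l o = q.+1.
  exact: (sum_tangents pl1 (osz o) (fun l => le2 l o)).
have st' l : \sum_o tan i1 i2 l o = q.+1.
  under eq_bigr do rewrite -tanC.
  exact: (sum_tangents pl2 (lsz l) (fun o => bundle_le2 (bundle_sym bd) o l)).
apply: square_design_plane (plane_lines pl1) (plane_lines pl2) => o o'.
apply/esym; move: o'; apply: eq_of_leq_sum => [o'|].
  have [<-|oo'] := eqVneq o o'.
    by rewrite muln1 addn1 -(st o) leq_sum // => l _; case: (tan _ _ l o).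
  have com : \sum_p i2 p o * i2 p o' = 1 by rewrite (plane_meet pl2) (negPf oo') muln0.
  have := odd_common_tangents pl1 (osz o) (osz o') com
            (fun l => le2 l o) (fun l => le2 l o') q_odd.
  by rewrite muln0 add0n; apply: odd_gt0.
(* Each of the [q + 1] tangents of [o] touches [q + 1] ovals, and
   [(q + 1)^2 = q + (q^2 + q + 1)]. *)
rewrite exchange_big /=.
under eq_bigr do rewrite -big_distrr st'.
rewrite -big_distrl /= st big_split /= sum1_card (plane_lines pl2).
by rewrite -big_distrr /= (bigD1 o) //= eqxx; lia.
Qed.

Lemma min_weight_even_card_lines (S1 : {set L}) (S2 : {set O}) :
  1 < q -> codeword i1 i2 S1 S2 -> ~~ odd #|S1| -> 0 < #|S2| ->
  q + 2 <= #|S1| + #|S2| /\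
  (#|S1| + #|S2| = q + 2 -> exists o, S2 = [set o] /\ S1 = [set l | tan i1 i2 l o]).
Proof.
move=> q_gt1 cw S1_even S2_gt0.
have S1E : S1 = [set l | odd (\sum_(o in S2) tan i1 i2 l o)].
  apply/setP => l; rewrite inE (codeword_tangents bd _ cw).
  by rewrite oddD (negPf S1_even) oddM q_odd oddb.
have := odd_degree_lb (plane_meet tangency_plane) S2.
rewrite -S1E => lb; split; first by nia.
move=> wt; have [S2_1|] := eqVneq #|S2| 1.
  have /eqP/cards1P[o S2o] := S2_1.
  exists o; split => //; rewrite S1E; apply/setP => l.
  by rewrite !inE S2o big_set1 oddb.
(* With [b] ovals the bound reads [(b - 1)(q + 2 - b) <= 0], leaving [b = q + 2] and no lines. Since
   [b] and [q] are odd, the inner product with any oval then puts it in [S2], which is too small to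
   contain all. *)
move=> S2_1; have S1_0 : #|S1| = 0 by nia.
have S10 : S1 = set0 by apply: cards0_eq.
suff S2T : S2 = [set: O].
  by move: wt; rewrite S1_0 S2T cardsT (plane_lines (bundle_plane2 bd)); nia.
apply/setP => o; rewrite inE.
have := codeword_tangents (bundle_sym bd) o (codeword_sym cw).
rewrite S10 big_set0 oddD oddM q_odd oddb /=.
by move: wt; rewrite S1_0 add0n => ->; rewrite oddD q_odd; case: (_ \in _).
Qed.

Lemma weight_odd_odd (S1 : {set L}) (S2 : {set O}) :
  1 < q -> codeword i1 i2 S1 S2 -> odd #|S1| -> odd #|S2| -> q + 2 < #|S1| + #|S2|.
Proof.
move=> q_gt1 cw S1_odd S2_odd.
have := covered_ub (plane_meet tangency_plane) (odd_gt0 S2_odd).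
have : #|~: S1| <= #|[set l | 0 < \sum_(o in S2) tan i1 i2 l o]|.
  apply: subset_leq_card; apply/subsetP => l; rewrite !inE => lS1.
  apply: odd_gt0; rewrite (codeword_tangents bd _ cw).
  by rewrite (negPf lS1) muln0 addn0.
have := cardsC S1; rewrite (plane_lines (bundle_plane1 bd)).
(* For [b = q] the covering bound gives weight at least [2q], which exceeds [q + 2] only if [q > 2];
   for [b = q + 1] it would be vacuous, but that [b] is even. *)
have := odd_gt0 S1_odd; have : q != 2 by case: eqP q_odd => // ->.
have : #|S2| != q.+1 by apply: contraTneq S2_odd => ->; rewrite /= q_odd.
by case: (ltngtP #|S2| q.+1) => //; nia.
Qed.

End Odd.

Lemma min_weight_odd (P L O : finType) q (i1 : P -> L -> bool) (i2 : P -> O -> bool)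
    (S1 : {set L}) (S2 : {set O}) :
  bundle q i1 i2 -> odd q -> 1 < q -> codeword i1 i2 S1 S2 -> 0 < #|S1| + #|S2| ->
  q + 2 <= #|S1| + #|S2| /\
  (#|S1| + #|S2| = q + 2 ->
     (exists o, S2 = [set o] /\ S1 = [set l | tan i1 i2 l o]) \/
     (exists l, S1 = [set l] /\ S2 = [set o | tan i1 i2 l o])).
Proof.
move=> bd q_odd q_gt1 cw wt.
have swap : ~~ odd #|S2| -> 0 < #|S1| -> q + 2 <= #|S1| + #|S2| /\
  (#|S1| + #|S2| = q + 2 -> exists l, S1 = [set l] /\ S2 = [set o | tan i1 i2 l o]).
  move=> S2_even S1_gt0; rewrite [#|S1| + _]addnC.
  have [lb ch] := min_weight_even_card_lines (bundle_sym bd) q_odd q_gt1 (codeword_sym cw)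
                    S2_even S1_gt0.
  split=> // /ch[l [-> ->]]; exists l; split=> //.
  by apply/setP => o; rewrite !inE tanC.
case: (boolP (odd #|S1|)) => S1_par; last first.
  have [S2_0|S2_gt0] := posnP #|S2|.
    by have [||lb ch] := swap; [rewrite S2_0 | lia | split=> // /ch; right].
  have [lb ch] := min_weight_even_card_lines bd q_odd q_gt1 cw S1_par S2_gt0.
  by split=> // /ch; left.
case: (boolP (odd #|S2|)) => S2_par.
  by have := weight_odd_odd bd q_odd q_gt1 cw S1_par S2_par; split; lia.
by have [||lb ch] := swap; [| exact: odd_gt0 | split=> // /ch; right].
Qed.

(** * PG(2,q) *)

Section ProjectivePlane.
Variable F : finFieldType.
Local Notation q := #|F|.

Lemma card_field_gt1 : 1 < q.
Proof. exact: finRing_gt1. Qed.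

Lemma PGpointP (U : 'M[F]_3) : reflect (<<U>>%MS = U /\ \rank U = 1) (U \in PGpoint F).
Proof. by rewrite inE; apply: (iffP andP) => -[/eqP ? /eqP ?]. Qed.

Lemma PGlineP (U : 'M[F]_3) : reflect (<<U>>%MS = U /\ \rank U = 2) (U \in PGline F).
Proof. by rewrite inE; apply: (iffP andP) => -[/eqP ? /eqP ?]. Qed.

(** The orthogonal complement for the standard dot product, in canonical form. *)
Definition perp (U : 'M[F]_3) : 'M[F]_3 := <<kermx U^T>>%MS.

Lemma rank_perp U : \rank (perp U) = 3 - \rank U.
Proof. by rewrite genmxE mxrank_ker mxrank_tr. Qed.

Lemma perpC (U V : 'M[F]_3) : (U <= perp V)%MS = (V <= perp U)%MS.
Proof.
rewrite !genmxE; apply/sub_kermxP/sub_kermxP => e.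
  by apply: trmx_inj; rewrite trmx_mul trmxK e trmx0.
by apply: trmx_inj; rewrite trmx_mul trmxK e trmx0.
Qed.

Lemma perpK (U : 'M[F]_3) : <<U>>%MS = U -> perp (perp U) = U.
Proof.
move=> gU; rewrite -[RHS]gU /perp -[LHS]genmx_id; apply/esym/genmxP.
rewrite -(geq_leqif (mxrank_leqif_eq _)); last by rewrite -/(perp _) -/(perp _) perpC.
by rewrite -/(perp _) -/(perp _) !rank_perp; have := rank_leq_row U; lia.
Qed.

(* Every point of [U] carries [q - 1] of its [q ^ rank U - 1] nonzero vectors. *)
Lemma card_points_in (U : 'M[F]_3) :
  #|[set p in PGpoint F | (p <= U)%MS]| * (q - 1) = q ^ \rank U - 1.
Proof.
have nz (V : 'M[F]_3) : #|rowg V :\ 0%R| = q ^ \rank V - 1.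
  by rewrite -card_rowg (cardsD1 0%R (rowg V)) mem_rowg sub0mx addKn.
rewrite -nz -[RHS]sum1_card.
have rk1 (v : 'rV[F]_3) : v != 0%R -> \rank v = 1 by rewrite rank_rV => ->.
rewrite (partition_big (fun v => <<v>>%MS)
           (fun p => p \in [set p in PGpoint F | (p <= U)%MS])) /=; last first.
  move=> v; rewrite !inE => /andP[v0 vU].
  by rewrite genmx_id !mxrank_gen rk1 // genmxE vU eqxx.
rewrite -sum_nat_const; apply: eq_bigr => p.
rewrite inE => /andP[/PGpointP[gp rp] pU].
rewrite -[q]expn1 -{1}rp -nz -sum1_card; apply: eq_bigl => v.
rewrite !inE; case: (eqVneq v 0%R) => //= v0.
rewrite -{2}gp; apply/idP/andP => [vp|[_ /eqP/genmxP/andP[]]//].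
split; first exact: submx_trans vp pU.
by apply/eqP/genmxP; rewrite -(mxrank_leqif_eq vp) rk1 // rp.
Qed.

Lemma card_PGpoint : #|PGpoint F| = q ^ 2 + q + 1.
Proof.
have := card_points_in 1%:M%R; rewrite mxrank1.
have -> : [set p in PGpoint F | (p <= (1%:M%R : 'M[F]_3))%MS] = PGpoint F.
  by apply/setP => p; rewrite [in LHS]inE submx1 andbT.
have := card_field_gt1; nia.
Qed.

Lemma perp_point U : U \in PGpoint F -> perp U \in PGline F.
Proof. by case/PGpointP => _ rU; apply/PGlineP; rewrite rank_perp rU genmx_id. Qed.

Lemma perp_line U : U \in PGline F -> perp U \in PGpoint F.
Proof. by case/PGlineP => _ rU; apply/PGpointP; rewrite rank_perp rU genmx_id. Qed.

Lemma card_PGline : #|PGline F| = q ^ 2 + q + 1.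
Proof.
rewrite -card_PGpoint.
have <- : perp @: PGpoint F = PGline F.
  apply/setP => l; apply/imsetP/idP => [[p pP ->]|lL]; first exact: perp_point.
  by exists (perp l); [exact: perp_line | rewrite perpK //; case/PGlineP: lL].
rewrite card_in_imset // => U V /PGpointP[gU _] /PGpointP[gV _] e.
by rewrite -(perpK gU) e perpK.
Qed.

Lemma card_line_points l :
  l \in PGline F -> #|[set p in PGpoint F | incident p l]| = q + 1.
Proof.
case/PGlineP => _ rl; have := card_points_in l; rewrite rl.
have := card_field_gt1; rewrite /incident; nia.
Qed.

(** The ranks of sum and intersection add up to 4 and the sum has rank at most 3; an intersection of
    rank 2 would equal both lines. *)
Lemma card_meet_points l l' :
  l \in PGline F -> l' \in PGline F -> l != l' ->
  #|[set p in PGpoint F | incident p l && incident p l']| = 1.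
Proof.
move=> /PGlineP[gl rl] /PGlineP[gl' rl'] ll'.
have rk : \rank (l :&: l')%MS = 1.
  have := mxrank_sum_cap l l'; rewrite rl rl'.
  have := rank_leq_row (l + l')%MS.
  have := mxrankS (capmxSl l l'); rewrite rl => le2.
  have : \rank (l :&: l')%MS != 2; last by lia.
  apply: contraNneq ll' => rk2.
  have e1 : (l :&: l' == l)%MS by rewrite -(mxrank_leqif_eq (capmxSl l l')) rk2 rl.
  have e2 : (l :&: l' == l')%MS by rewrite -(mxrank_leqif_eq (capmxSr l l')) rk2 rl'.
  by rewrite -gl -gl' -(genmxP e1) -(genmxP e2).
have := card_points_in (l :&: l')%MS; rewrite rk expn1.
have -> : [set p in PGpoint F | (p <= l :&: l')%MS] =
          [set p in PGpoint F | incident p l && incident p l'].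
  by apply/setP => p; rewrite inE [in RHS]inE sub_capmx.
have := card_field_gt1; nia.
Qed.

End ProjectivePlane.

Lemma sum_and (T : finType) (A : {set T}) (b c : T -> bool) :
  \sum_(x : {x | x \in A}) b (val x) * c (val x) = #|[set x in A | b x && c x]|.
Proof.
rewrite -(big_sub (mem A) (fun x => b x * c x : nat)) -(sum_bool _ (fun x => b x && c x)).
by apply: eq_bigr => x _; rewrite mulnb.
Qed.

(** * A projective bundle as a second plane on the points of PG(2,q) *)

Section BundleOfPG.
Variables (F : finFieldType) (G : {set {set 'M[F]_3}}).
Local Notation q := #|F|.
Local Notation point := {p : 'M[F]_3 | p \in PGpoint F}.
Local Notation line := {l : 'M[F]_3 | l \in PGline F}.
Local Notation oval := {o : {set 'M[F]_3} | o \in G}.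

(** Subtypes are used because the abstract planes count over whole finite types. *)
Definition on_line (p : point) (l : line) : bool := incident (val p) (val l).
Definition on_oval (p : point) (o : oval) : bool := val p \in val o.

Lemma PG_plane : plane q on_line.
Proof.
apply: square_design_plane; last 2 first.
- by rewrite card_sig -card_PGpoint.
- by rewrite card_sig -card_PGline.
move=> l l'; rewrite (sum_and _ (fun p => incident p (val l)) (fun p => incident p (val l'))).
have [<-|ll'] := eqVneq l l'; last first.
  by rewrite muln0; apply: card_meet_points (valP l) (valP l') _; rewrite val_eqE.
by rewrite muln1 -(card_line_points (valP l)); under eq_finset do rewrite andbb.
Qed.

Hypothesis bG : projective_bundle G.

Lemma bundle_oval o : o \in G ->
  [/\ o \subset PGpoint F, #|o| = q + 1 &
      forall l, l \in PGline F -> #|[set p in o | incident p l]| <= 2].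
Proof.
move=> oG; case/and3P: bG => /forall_inP/(_ o oG)/and3P[sub /eqP co /forall_inP le2] _ _.
by split.
Qed.

Lemma inter_card (l : line) (o : oval) :
  inter on_line (fun p => on_oval p o) l = #|[set p in val o | incident p (val l)]|.
Proof.
rewrite /inter (sum_and _ (fun p => incident p (val l)) (fun p => p \in val o)).
have [sub _ _] := bundle_oval (valP o).
apply: eq_card => p; rewrite in_set [in RHS]in_set andbCA.
case: (boolP (p \in val o)) => po; last by rewrite !andbF.
by rewrite (subsetP sub p po) !andbT andTb.
Qed.

Lemma tan_tangent (l : line) (o : oval) :
  tan on_line on_oval l o = tangent (val l) (val o).
Proof. by rewrite /tan /is_tangent inter_card. Qed.

Lemma PG_bundle : bundle q on_line on_oval.
Proof.
split; first exact: PG_plane.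
  apply: square_design_plane; last 2 first.
  - by rewrite card_sig -card_PGpoint.
  - by rewrite card_sig; case/and3P: bG => _ /eqP.
  move=> o o'; rewrite (sum_and _ (fun p => p \in val o) (fun p => p \in val o')).
  have [sub co _] := bundle_oval (valP o).
  have -> : [set p in PGpoint F | (p \in val o) && (p \in val o')] = val o :&: val o'.
    apply/setP => p; rewrite in_set in_setI.
    by case: (boolP (p \in val o)) => [/(subsetP sub)->|]; rewrite ?andbF.
  have [<-|oo'] := eqVneq o o'; first by rewrite setIid co muln1.
  case/and3P: bG => _ _ /forall_inP/(_ _ (valP o))/forall_inP/(_ _ (valP o')).
  by rewrite val_eqE oo' => /eqP->; rewrite muln0.
move=> l o; rewrite -/(inter on_line (fun p => on_oval p o) l) inter_card.
by case: (bundle_oval (valP o)) => _ _; apply; exact: valP.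
Qed.

End BundleOfPG.

(** * The code *)

(** Supports live in the ambient type; this moves them to the subtypes on which the planes are
    defined. *)
Definition subpreim (T : finType) (A B : {set T}) : {set {x | x \in A}} :=
  [set x | val x \in B].

Lemma subpreimK (T : finType) (A B : {set T}) :
  B \subset A -> val @: subpreim A B = B.
Proof.
move=> sBA; apply/setP => x; apply/imsetP/idP => [[y]|xB]; first by rewrite inE => yB ->.
by exists (Sub x (subsetP sBA x xB)); rewrite ?inE.
Qed.

Lemma card_subpreim (T : finType) (A B : {set T}) : B \subset A -> #|subpreim A B| = #|B|.
Proof. by move=> sBA; rewrite -(card_imset _ val_inj) subpreimK. Qed.

Lemma sum_subpreim (T : finType) (A B : {set T}) (b : T -> bool) :
  B \subset A -> \sum_(x in subpreim A B) b (val x) = #|[set x in B | b x]|.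
Proof.
move=> sBA; rewrite -[in RHS](subpreimK sBA) -sum_bool big_imset //=.
by move=> x y _ _; apply: val_inj.
Qed.

Lemma F2_natr_odd n : (n%:R = (odd n)%:R :> 'F_2)%R.
Proof.
rewrite -{1}(odd_double_half n) GRing.natrD -mul2n GRing.natrM.
by rewrite (GRing.pcharf0 (pchar_Fp (isT : prime 2))) GRing.mul0r GRing.addr0.
Qed.

Lemma F2_natr_add_eq0 m n : ((m%:R + n%:R == 0 :> 'F_2) = (odd m == odd n))%R.
Proof. by rewrite F2_natr_odd (F2_natr_odd n); case: (odd m); case: (odd n). Qed.

Lemma F2_val (x : 'F_2) : x = ((x != 0)%R%:R)%R.
Proof. by apply/eqP; move: x; do 3?case. Qed.

Section Code.
Variables (F : finFieldType) (G : {set {set 'M[F]_3}}).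

(** A sum over ['F_2] is the size of a support modulo 2, which turns the kernel equation into the
    parity condition [codeword]. *)
Lemma F2_sum (T : finType) (A : {set T}) (c : {ffun T -> 'F_2}) (b : T -> bool) :
  [set x | c x != 0%R] \subset A ->
  (\sum_(x in A) c x * (if b x then 1 else 0) =
   (\sum_(x in subpreim A [set x | c x != 0%R]) b (val x))%N%:R)%R.
Proof.
move=> sA; rewrite (sum_subpreim _ sA) -sum_bool GRing.natr_sum.
rewrite big_mkcond [RHS]big_mkcond; apply: eq_bigr => x _.
rewrite [in RHS]inE {1}(F2_val (c x)).
case: (boolP (x \in A)) => xA.
  by case: (c x != 0%R); rewrite /= ?GRing.mul1r ?GRing.mul0r //; case: (b x).
suff /negPf-> : ~~ (c x != 0%R) by [].
by apply: contra xA => cx; apply: (subsetP sA); rewrite inE.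
Qed.

Lemma in_codeP cL cO :
  in_code G cL cO <->
  [/\ suppL cL \subset PGline F, suppO cO \subset G &
      codeword (@on_line F) (@on_oval F G)
        (subpreim (PGline F) (suppL cL)) (subpreim G (suppO cO))].
Proof.
split.
  case=> cL0 cO0 cw.
  have sL : suppL cL \subset PGline F.
    by apply/subsetP => l; rewrite inE; apply: contraR => /cL0->.
  have sO : suppO cO \subset G.
    by apply/subsetP => o; rewrite inE; apply: contraR => /cO0->.
  split=> // p; apply/eqP; rewrite -F2_natr_add_eq0 -(cw _ (valP p)).
  by rewrite (F2_sum (fun l => incident (val p) l) sL) (F2_sum (fun o : {set 'M[F]_3} => val p \in o) sO).
case=> sL sO cw; split.
- by move=> l; apply: contraNeq => cl; apply: (subsetP sL); rewrite inE.
- by move=> o; apply: contraNeq => co; apply: (subsetP sO); rewrite inE.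
move=> p pP; apply/eqP.
rewrite (F2_sum (fun l => incident p l) sL) (F2_sum (fun o : {set 'M[F]_3} => p \in o) sO) F2_natr_add_eq0.
by rewrite (cw (Sub p pP)).
Qed.

Lemma in_code_exists (S1 : {set {l | l \in PGline F}}) (S2 : {set {o | o \in G}}) :
  codeword (@on_line F) (@on_oval F G) S1 S2 ->
  exists cL cO, in_code G cL cO /\ weight cL cO = #|S1| + #|S2|.
Proof.
move=> cw.
pose c (T : finType) (B : {set T}) := [ffun x => if x \in B then 1%R else 0%R : 'F_2].
have cE (T : finType) (B : {set T}) : [set x | c T B x != 0%R] = B.
  by apply/setP => x; rewrite inE ffunE; case: (x \in B).
exists (c _ (val @: S1)), (c _ (val @: S2)).
have pK (T : finType) (A : {set T}) (S : {set {x | x \in A}}) : subpreim A (val @: S) = S.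
  by apply/setP => x; rewrite inE mem_imset //; apply: val_inj.
have sub (T : finType) (A : {set T}) (S : {set {x | x \in A}}) : val @: S \subset A.
  by apply/subsetP => _ /imsetP[x _ ->]; apply: valP.
split; last by rewrite /weight /suppL /suppO !cE !card_imset //; apply: val_inj.
by apply/in_codeP; rewrite /suppL /suppO !cE !pK; split.
Qed.

End Code.

Local Open Scope ring_scope.

Theorem theorem4p13 (F : finFieldType) (G : {set {set 'M[F]_3}}) :
  projective_bundle G ->
  (* minimum distance is q + 2 *)
  ((exists (cL : {ffun 'M[F]_3 -> 'F_2}) (cO : {ffun {set 'M[F]_3} -> 'F_2}),
       in_code G cL cO /\ weight cL cO = (#|F| + 2)%N) /\
   (forall (cL : {ffun 'M[F]_3 -> 'F_2}) (cO : {ffun {set 'M[F]_3} -> 'F_2}),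
       in_code G cL cO -> weight cL cO <> 0%N -> (#|F| + 2 <= weight cL cO)%N)) /\
  (* supports of minimum weight codewords *)
  (forall (cL : {ffun 'M[F]_3 -> 'F_2}) (cO : {ffun {set 'M[F]_3} -> 'F_2}),
     in_code G cL cO -> weight cL cO = (#|F| + 2)%N ->
     if odd #|F| then
       (exists2 O, O \in G &
          suppO cO = [set O] /\ suppL cL = [set l in PGline F | tangent l O]) \/
       (exists2 l, l \in PGline F &
          suppL cL = [set l] /\ suppO cO = [set O in G | tangent l O])
     else
       (dual_hyperoval (suppL cL) /\ suppO cO = set0) \/
       (suppL cL = set0 /\ hyperoval_of_ovals G (suppO cO))).
Proof.
move=> bG; have bd := PG_bundle bG; have [pl1 pl2 le2] := bd.
have q_gt1 := card_field_gt1 F.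
(* Both words of weight [q + 2] start from one oval of the bundle: with its tangents for odd [q],
   with its nucleus and then dualised by [perp] for even [q]. *)
have [o _] : exists o : {o | o \in G}, true.
  by have /card_gt0P[o _] : (0 < #|{: {o | o \in G}}|)%N; [rewrite (plane_lines pl2) addn1 | exists o].
have supp cL cO : in_code G cL cO ->
    [/\ suppL cL \subset PGline F, suppO cO \subset G,
        weight cL cO = (#|subpreim (PGline F) (suppL cL)| + #|subpreim G (suppO cO)|)%N &
        codeword (@on_line F) (@on_oval F G)
          (subpreim (PGline F) (suppL cL)) (subpreim G (suppO cO))].
  by case/in_codeP => sL sO cw; split; rewrite ?card_subpreim.
split; first split.
- have [q_odd|q_even] := boolP (odd #|F|).
    have [cL [cO [cw wt]]] := in_code_exists (oval_tangents_codeword bd o q_odd).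
    exists cL, cO; split=> //; rewrite wt (card_tangents bd) cards1; lia.
  pose pp (p : {p | p \in PGpoint F}) : {l | l \in PGline F} :=
    Sub (perp (val p)) (perp_point (valP p)).
  have pp_inj : injective pp.
    move=> p p' /(congr1 val) /= e; apply: val_inj => /=.
    have /PGpointP[gp _] := valP p; have /PGpointP[gp' _] := valP p'.
    by rewrite -(perpK gp) e perpK.
  have ppC p p' : on_line p (pp p') = on_line p' (pp p) by apply: perpC.
  have [S [cS ev]] := dual_hyperoval_exists pl1 q_even (ltnW q_gt1)
    (block_size (plane_meet pl2) o) (fun l => le2 l o) pp_inj ppC.
  have cw : codeword (@on_line F) (@on_oval F G) S set0.
    by move=> p; rewrite big_set0 (negPf (ev p)).
  have [cL [cO [? wt]]] := in_code_exists cw.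
  by exists cL, cO; split; rewrite // wt cS cards0 addn0.
- move=> cL cO /supp[sL sO -> cw] /eqP; rewrite -lt0n => wt.
  have [q_odd|q_even] := boolP (odd #|F|).
    exact: (min_weight_odd bd q_odd q_gt1 cw wt).1.
  exact: (min_weight_even bd q_even (ltnW q_gt1) cw wt).1.
move=> cL cO /supp[sL sO -> cw] wt.
have wt0 : (0 < #|subpreim (PGline F) (suppL cL)| + #|subpreim G (suppO cO)|)%N.
  by rewrite wt addn2.
case: ifPn => [q_odd|q_even].
  have [_ /(_ wt)[[a [S2 S1]]|[l [S1 S2]]]] := min_weight_odd bd q_odd q_gt1 cw wt0.
    left; exists (val a); first exact: valP.
    rewrite -(subpreimK sO) S2 imset_set1; split=> //.
    apply/setP => l; rewrite [in RHS]inE; apply/idP/andP => [lS|[lL lt]].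
      have lL := subsetP sL l lS; split=> //.
      have : Sub l lL \in subpreim (PGline F) (suppL cL) by rewrite inE.
      by rewrite S1 inE (tan_tangent bG).
    have : Sub l lL \in subpreim (PGline F) (suppL cL).
      by rewrite S1 inE (tan_tangent bG).
    by rewrite inE.
  right; exists (val l); first exact: valP.
  rewrite -(subpreimK sL) S1 imset_set1; split=> //.
  apply/setP => a; rewrite [in RHS]inE; apply/idP/andP => [aS|[aG a_tan]].
    have aG := subsetP sO a aS; split=> //.
    have : Sub a aG \in subpreim G (suppO cO) by rewrite inE.
    by rewrite S2 inE (tan_tangent bG).
  have : Sub a aG \in subpreim G (suppO cO) by rewrite S2 inE (tan_tangent bG).
  by rewrite inE.
have [_ /(_ wt)[S0|S0]] := min_weight_even bd q_even (ltnW q_gt1) cw wt0.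
  (* Without lines, the [q + 2] ovals form an even set in the dual of the plane of ovals, so each
     point has degree 0 or 2. *)
  right; split; first by rewrite -(subpreimK sL) S0 imset0.
  move: wt; rewrite S0 cards0 add0n => wt.
  apply/and3P; split=> //; first by rewrite -(card_subpreim sO) wt.
  apply/forall_inP => p pP.
  rewrite -(sum_subpreim (fun a : {set 'M[F]_3} => p \in a) sO).
  apply: (even_set_degrees (plane_dual pl2) (Sub p pP) wt) => p'.
  by rewrite -cw S0 big_set0.
left; split; last by rewrite -(subpreimK sO) S0 imset0.
move: wt; rewrite S0 cards0 addn0 => wt.
apply/and3P; split=> //; first by rewrite -(card_subpreim sL) wt.
apply/forall_inP => p pP.
rewrite -(sum_subpreim (fun l => incident p l) sL).
apply: (even_set_degrees (plane_dual pl1) (Sub p pP) wt) => p'.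
by rewrite cw S0 big_set0.
Qed.
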